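(* The derived algebra of the Lie algebra $\mathfrak{L}_0(q)$ is precisely the set of all compact elements of $\mathcal{H}(q)$, i.e. the set of all $X\in\mathcal{H}(q)$ that are compact operators on $\mathfrak{H}$.
   Context: Fix a real number $q$ with $0<q<1$. Let $\mathbb{N}=\{0,1,2,\ldots\}$, let $\mathbb{Z}^+$ be the set of positive integers, and $\{n\}_q:=1+q+\cdots+q^{n-1}=\frac{1-q^n}{1-q}$ (so $\{0\}_q=0$). Let $\mathfrak{H}$ be an infinite-dimensional separable complex Hilbert space with a complete orthonormal basis $\{\Phi_n : n\in\mathbb{N}\}$, and let $\mathfrak{B}(\mathfrak{H})$ be the algebra of bounded linear operators on $\mathfrak{H}$. Let $A,B\in\mathfrak{B}(\mathfrak{H})$ be the bounded operators determined by $B\Phi_n=\sqrt{\{n+1\}_q}\,\Phi_{n+1}$ for $n\ge 0$, $A\Phi_n=\sqrt{\{n\}_q}\,\Phi_{n-1}$ for $n\geq 1$, and $A\Phi_0=0$. They satisfy $AB-qBA=I$. Let $\mathcal{H}(q)$ denote the unital subalgebra of $\mathfrak{B}(\mathfrak{H})$ generated by $A,B$ (no topological closure is taken; it is a faithful copy of the abstract $q$-deformed Heisenberg algebra generated by $A,B$ subject to $AB-qBA=I$). $\mathcal{H}(q)$ is a Lie algebra over $\mathbb{C}$ under $[f,g]:=fg-gf$. $\mathfrak{L}_0(q)$ is the linear span of the elements $A$, $B$, $[A,B]^k$, $[A,B]^kA^l$, $B^l[A,B]^k$ with $k,l\in\mathbb{Z}^+$, where $[A,B]^k$ denotes the $k$-th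 power of the operator $[A,B]=AB-BA$; it is a Lie subalgebra of $\mathcal{H}(q)$ (in fact the Lie subalgebra generated by $A,B$). The derived algebra of a Lie algebra $\mathfrak{K}$ is the linear span of all $[x,y]$ with $x,y\in\mathfrak{K}$. *)

(* Defs.v *)
From HB Require Import structures.
From mathcomp Require Import all_boot all_order all_algebra.
From mathcomp Require Import sesquilinear complex.
From mathcomp Require Import all_classical all_reals all_analysis.
Set Implicit Arguments.
Unset Strict Implicit.
Unset Printing Implicit Defensive.
Import Order.TTheory GRing.Theory Num.Theory.
Import numFieldNormedType.Exports.
Local Open Scope classical_set_scope.
Local Open Scope ring_scope.
Local Open Scope complex_scope.

Section Span.
Context {K : pzRingType} {V : lmodType K}.

Definition lin_span (G : set V) : set V :=
  smallest (fun S : set V => submod_closed [in S]) G.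

End Span.

(* Operators are plain functions H -> H; their linear structure is the
   pointwise one and their product is composition, so that the k-th power of T
   is iter k T. *)
Section Operators.
Context {K : numFieldType} {H : normedModType K}.
Implicit Types (T X Y : H -> H) (L : set (H -> H)).

Definition bounded_operator T :=
  linear T /\ exists M : K, forall x, `|T x| <= M * `|x|.

Definition compact_operator T :=
  linear T /\ precompact (T @` [set x | `|x| <= 1]).

Definition unital_subalgebra (S : set (H -> H)) :=
  [/\ S `<=` bounded_operator, S id, submod_closed [in S] &
      forall X Y, S X -> S Y -> S (X \o Y)].

Definition generated_algebra (G : set (H -> H)) : set (H -> H) :=
  smallest unital_subalgebra G.

Definition lie X Y : H -> H := (X \o Y) - (Y \o X).

Definition derived_algebra L : set (H -> H) :=
  lin_span [set lie X Y | X in L & Y in L].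

Definition heisenberg_algebra A B := generated_algebra [set A; B].

Definition L0 A B : set (H -> H) :=
  let C := lie A B in
  let pos := [set k : nat | (0 < k)%N] in
  lin_span ([set A; B]
    `|` [set iter k C | k in pos]
    `|` [set iter k C \o iter l A | k in pos & l in pos]
    `|` [set iter l B \o iter k C | k in pos & l in pos]).

End Operators.

Definition qnat {R : pzRingType} (q : R) (n : nat) : R := \sum_(i < n) q ^+ i.

Section Hilbert.
Context {R : realType} {H : completeNormedModType R[i]}.

(* The norm of the complete space H is the one of the inner product ip, which
   is linear on the left and conjugate-linear on the right. *)
Definition hilbert_norm (ip : {dot H for Num.conj}) :=
  forall x, ip x x = `|x| ^+ 2.

Definition complete_orthonormal (ip : {dot H for Num.conj}) (Phi : nat -> H) :=
  (forall m n, ip (Phi m) (Phi n) = (m == n)%:R) /\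
  closure (lin_span (range Phi)) = [set: H].

Definition q_annihilation (q : R) (Phi : nat -> H) (A : H -> H) :=
  A (Phi 0) = 0 /\
  forall n, A (Phi n.+1) = (Num.sqrt (qnat q n.+1))%:C *: Phi n.

Definition q_creation (q : R) (Phi : nat -> H) (B : H -> H) :=
  forall n, B (Phi n) = (Num.sqrt (qnat q n.+1))%:C *: Phi n.+1.

End Hilbert.

(* Main.v *)
(* Put C = [A,B]. The relation AB - qBA = 1 gives C = 1 - (1-q)BA, AC = qCA and
   CB = qBC, so the normal-ordered monomials C^k A^l and B^l C^k with k >= 1 span
   a two-sided ideal I of H(q). The derived algebra of L_0(q) is I: modulo I the
   algebra L_0(q) is spanned by A and B, whose bracket C lies in I; conversely
   [C^k A^l, A] = (1-q^k) C^k A^(l+1), [B, B^l C^k] = (1-q^k) B^(l+1) C^k, and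
   [A, B C^k] is a combination of C^k and C^(k+1) with nonzero coefficient at
   C^(k+1). Since C Phi_n = q^n Phi_n, C is compact, hence so is every element of
   I. Finally H(q) is spanned by I and the powers of A and B, and a nonzero
   combination of such powers is not compact. *)

Require Import Defs.
From mathcomp Require Import all_boot all_order all_algebra.
From mathcomp Require Import sesquilinear complex.
From mathcomp Require Import all_classical all_reals all_analysis.
From mathcomp Require Import zify.
Import Order.TTheory GRing.Theory Num.Theory.
Import numFieldNormedType.Exports.
Local Open Scope classical_set_scope.
Local Open Scope ring_scope.

(** * Linear spans and total boundedness *)

Section LinSpan.
Context {K : pzRingType} {V : lmodType K}.
Implicit Types (G S : set V) (u v : V).

Lemma submod_closedP S :
  submod_closed [in S] <-> S 0 /\ forall a u v, S u -> S v -> S (a *: u + v).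
Proof.
split=> -[S0 SL]; split.
- by move: S0; rewrite inE.
- by move=> a u v Su Sv; have := SL a u v; rewrite !inE; apply.
- by rewrite inE.
- by move=> a u v; rewrite !inE; exact: SL.
Qed.

Lemma sub_lin_span G : G `<=` lin_span G.
Proof. exact: sub_smallest. Qed.

Lemma lin_span_ind G S :
  S 0 -> (forall a u v, S u -> S v -> S (a *: u + v)) -> G `<=` S ->
  lin_span G `<=` S.
Proof. by move=> S0 SL GS; apply: smallest_sub => //; apply/submod_closedP. Qed.

Lemma lin_span0 G : lin_span G 0.
Proof. by move=> S [/submod_closedP[]]. Qed.

Lemma lin_spanP G a u v :
  lin_span G u -> lin_span G v -> lin_span G (a *: u + v).
Proof.
move=> Gu Gv S SG; have /submod_closedP[_ SL] := SG.1.
by apply: SL; [exact: Gu|exact: Gv].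
Qed.

Lemma lin_spanZ G a u : lin_span G u -> lin_span G (a *: u).
Proof.
by move=> Gu; rewrite -[a *: u]addr0; apply: lin_spanP => //; exact: lin_span0.
Qed.

Lemma lin_spanB G u v : lin_span G u -> lin_span G v -> lin_span G (u - v).
Proof. by move=> Gu Gv; rewrite addrC -scaleN1r; exact: lin_spanP. Qed.

(** The index list is duplicate-free so that pairing with an orthonormal family later isolates a
    single coefficient. *)
Lemma lin_span_sum_uniq (I : eqType) (f : I -> V) u :
  lin_span (range f) u ->
  exists (s : seq I) (c : I -> K), uniq s /\ u = \sum_(i <- s) c i *: f i.
Proof.
move: u; apply: lin_span_ind => [|a u v [s [c [us ->]]] [t [d [ut ->]]]|].
- by exists [::], (fun=> 0); rewrite big_nil.
- exists (undup (s ++ t)).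
  exists (fun i => (if i \in s then a * c i else 0) + (if i \in t then d i else 0)).
  split; first exact: undup_uniq.
  (* Both combinations are rewritten over the merged list, with coefficient zero off their own
     indices. *)
  have sumE (r : seq I) (e : I -> K) : uniq r -> {subset r <= undup (s ++ t)} ->
      \sum_(i <- r) e i *: f i =
      \sum_(i <- undup (s ++ t)) (if i \in r then e i else 0) *: f i.
    move=> ur rst.
    under [RHS]eq_bigr do rewrite (fun_if (fun x => x *: f _)) scale0r.
    rewrite -big_mkcond -big_filter; apply: perm_big; apply: uniq_perm => //.
      by rewrite filter_uniq ?undup_uniq.
    move=> i; rewrite mem_filter; case ri: (i \in r) => //=.
    by rewrite rst.
  rewrite scaler_sumr; under eq_bigr do rewrite scalerA.
  rewrite (sumE s (fun i => a * c i)) // ?(sumE t) // -?big_split /=.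
  + by apply: eq_bigr => i _; rewrite scalerDl.
  + by move=> i it; rewrite mem_undup mem_cat it orbT.
  + by move=> i is_; rewrite mem_undup mem_cat is_.
- move=> _ [i _ <-]; exists [:: i], (fun=> 1); split=> //.
  by rewrite big_seq1 scale1r.
Qed.

End LinSpan.

Section TotallyBounded.
Context {K : numFieldType} {V : normedModType K}.
Implicit Types S T : set V.

(** Centres need not belong to [S], so passing to a subset is immediate. In a complete space this
    amounts to precompactness, in the form suited to sums and Lipschitz images. *)
Definition totally_bounded S := forall e : K, 0 < e ->
  exists F : seq V, forall x, S x -> exists2 y, y \in F & `|x - y| < e.

Lemma totally_bounded_approx S :
  (forall e : K, 0 < e -> exists2 T, totally_bounded T &
    forall x, S x -> exists2 y, T y & `|x - y| < e) ->
  totally_bounded S.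
Proof.
move=> appS e e0; have e20 : 0 < e / 2 by rewrite divr_gt0.
have [T bT ST] := appS _ e20; have [F FT] := bT _ e20.
exists F => x /ST[y /FT[z zF yz] xy]; exists z => //.
by rewrite [e]splitr (le_lt_trans (ler_distD y _ _))// ltrD.
Qed.

Lemma totally_boundedS S T : S `<=` T -> totally_bounded T -> totally_bounded S.
Proof. by move=> ST bT e /bT[F FT]; exists F => x /ST/FT. Qed.

Lemma totally_boundedD S T : totally_bounded S -> totally_bounded T ->
  totally_bounded [set x + y | x in S & y in T].
Proof.
move=> bS bT e e0; have e20 : 0 < e / 2 by rewrite divr_gt0.
have [F FS] := bS _ e20; have [G GT] := bT _ e20.
exists [seq x + y | x <- F, y <- G] => _ [x /FS[x' Fx' xx'] [y /GT[y' Gy' yy']] <-].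
exists (x' + y'); first exact: allpairs_f.
by rewrite opprD addrACA [e]splitr (le_lt_trans (ler_normD _ _))// ltrD.
Qed.

(** Pigeonhole: among one more term than there are centres, two share a centre. This later refutes
    compactness. *)
Lemma totally_bounded_separated S (u : nat -> V) (e : K) : 0 < e ->
  totally_bounded S -> (forall n, S (u n)) ->
  exists i j, (i < j)%N /\ `|u j - u i| < e.
Proof.
move=> e0 bS uS; have e20 : 0 < e / 2 by rewrite divr_gt0.
have [F FS] := bS _ e20.
have FuP n : exists y, y \in F /\ `|u n - y| < e / 2.
  by have [y yF uy] := FS _ (uS n); exists y.
have [y yP] := choice FuP.
pose h (i : 'I_(size F).+1) : 'I_(size F) :=
  Ordinal (etrans (index_mem (y i) F) (yP i).1).
have : ~~ injectiveb h.
  apply/negP => /injectiveP/leq_card; by rewrite !card_ord ltnn.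

have near i j : y i = y j -> `|u j - u i| < e.
  move=> yij; rewrite [e]splitr (le_lt_trans (ler_distD (y i) _ _))//.
  by rewrite ltrD//; [rewrite yij; case: (yP j)|rewrite distrC; case: (yP i)].
move=> /injectivePn[i [j ij /(congr1 val)/= hij]].
have yij : y i = y j.
  by rewrite -(nth_index 0 (yP i).1) hij nth_index//; exact: (yP j).1.
have [ltij|ltji|eqij] := ltngtP i j.
- by exists i, j; split=> //; exact: near.
- by exists j, i; split=> //; exact: near.
- by rewrite (val_inj eqij) eqxx in ij.
Qed.

Lemma precompact_totally_bounded S : precompact S -> totally_bounded S.
Proof.
move=> [T ST [cT _]] e e0; apply: (@totally_boundedS _ T) => // {}e {}e0.
move: cT; rewrite compact_cover.
move=> /(_ V T (fun y => ball y e)) []; first by move=> y _; exact: ball_open.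
  by move=> x Tx; exists x => //; exact: ballxx.
move=> D DT TD; exists (finmap.enum_fset D) => x /TD[y yD /=].
by rewrite -ball_normE /= distrC => xy; exists y.
Qed.

End TotallyBounded.

(** An ultrafilter containing the closure of [S] is Cauchy, hence converges by completeness, and its
    limit stays in the closed set. *)
Lemma totally_bounded_precompact {K : numFieldType} {V : completeNormedModType K}
  (S : set V) : totally_bounded S -> precompact S.
Proof.
move=> bS; rewrite precompactE compact_ultra => F UF FS.
have bcS : totally_bounded (closure S).
  apply: totally_bounded_approx => e e0; exists S => // x.
  move=> /(_ _ (nbhsx_ballx x e e0))[y [Sy]].
  by rewrite -ball_normE /=; exists y.
have cF : cvg F.
  apply: cauchy_cvg; apply/cauchyP => e e0.
  have [G GS] := bcS e e0.
  (* If no ball of radius [e] is in [F], then all their complements are; finitely many of these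
     balls cover the closure, which forces the empty set into [F]. *)
  have [//|nex] := pselect (exists x, F (ball x e)).
  suff : F set0 by move=> /filter_ex[].
  have FG : F [set x | forall y, y \in G -> ~ ball y e x].
    elim: G {GS} => [|y G IH]; first by apply: filterS filterT.
    have [Fb|Fnb] := in_ultra_setVsetC (ball y e) UF.
      by exfalso; apply: nex; exists y.
    apply: (filterS _ (filterI Fnb IH)) => x [nyx Gx] z.
    by rewrite inE => /predU1P[->//|/Gx].
  apply: (filterS _ (filterI FS FG)) => x [/GS[y yG xy] /(_ y yG)].
  by apply; rewrite -ball_normE /= distrC.
exists (lim F); split=> //.
apply: closed_closure => B /cF FB.
exact: filter_ex (filterI FS FB).
Qed.

(** * Linear and bounded maps as plain functions *)

Section LinearMaps.
Context {K : numFieldType} {H : normedModType K}.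
Implicit Types (T X Y : H -> H) (x y : H).

Lemma linear_map0 T : linear T -> T 0 = 0.
Proof.
by move=> lT; have := lT (- 1) 0 0; rewrite scaler0 addr0 scaleN1r addNr.
Qed.

Lemma linear_mapZ T a x : linear T -> T (a *: x) = a *: T x.
Proof. by move=> lT; rewrite -[a *: x]addr0 lT linear_map0// addr0. Qed.

Lemma linear_mapD T x y : linear T -> T (x + y) = T x + T y.
Proof. by move=> lT; have := lT 1 x y; rewrite !scale1r. Qed.

Lemma linear_mapB T x y : linear T -> T (x - y) = T x - T y.
Proof.
by move=> lT; rewrite linear_mapD// -scaleN1r linear_mapZ// scaleN1r.
Qed.

Lemma linear_map_sum T (I : Type) (s : seq I) (c : I -> K) (f : I -> H) :
  linear T -> T (\sum_(i <- s) c i *: f i) = \sum_(i <- s) c i *: T (f i).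
Proof.
move=> lT; elim: s => [|i s IH]; first by rewrite !big_nil linear_map0.
by rewrite !big_cons lT IH.
Qed.

Lemma linear_iter T k : linear T -> linear (iter k T).
Proof. by move=> lT; elim: k => // k IH a x y; rewrite /= IH lT. Qed.

Lemma compD T X Y a : linear T -> T \o (a *: X + Y) = a *: (T \o X) + (T \o Y).
Proof. by move=> lT; apply/funext => x /=; rewrite lT. Qed.

Lemma comp0 T : linear T -> T \o (0 : H -> H) = 0.
Proof. by move=> lT; apply/funext => x /=; rewrite linear_map0. Qed.

Lemma lieE X Y x : lie X Y x = X (Y x) - Y (X x).
Proof. by []. Qed.

(** Later proofs divide by the bound, while [M] comes without a sign. Its product with the norm of
    [x] dominates a norm, so it is unchanged when [M] is replaced by its absolute value; adding 1
    makes the bound positive. *)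
Lemma bounded_operator_gt0 T : bounded_operator T ->
  exists2 M, 0 < M & forall x, `|T x| <= M * `|x|.
Proof.
move=> [_ [M TM]]; exists (`|M| + 1); first by rewrite ltr_wpDl.
move=> x; have Mx := TM x.
rewrite (le_trans Mx)// -[leLHS]ger0_norm ?(le_trans _ Mx)//.
by rewrite normrM normr_id ler_wpM2r// lerDl.
Qed.

Lemma bounded_operatorP (a : K) X Y : bounded_operator X -> bounded_operator Y ->
  bounded_operator (a *: X + Y).
Proof.
move=> [lX [M XM]] [lY [N YN]]; split.
  move=> b x y; rewrite !fctE lX lY !scalerDr !scalerA (mulrC a).
  by rewrite -!addrA; congr (_ + _); rewrite addrCA.
exists (`|a| * M + N) => x; rewrite mulrDl.
rewrite (le_trans (ler_normD _ _))// lerD// normrZ -mulrA.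
by rewrite ler_wpM2l// XM.
Qed.

Lemma bounded_operator_comp X Y : bounded_operator X -> bounded_operator Y ->
  bounded_operator (X \o Y).
Proof.
move=> bX [lY [N YN]]; have [M M0 XM] := bounded_operator_gt0 X bX.
split; first by move=> a x y /=; rewrite lY bX.1.
by exists (M * N) => x /=; rewrite (le_trans (XM _))// -mulrA ler_pM2l// YN.
Qed.

Lemma bounded_operator_unital : unital_subalgebra (@bounded_operator K H).
Proof.
split=> //.
- by split=> //; exists 1 => x; rewrite mul1r.
- apply/submod_closedP; split; last exact: bounded_operatorP.
  split; first by move=> a x y; rewrite -[LHS]/0 -[RHS]/(a *: 0 + 0) scaler0 addr0.
  by exists 0 => x; rewrite -[X in `|X|]/0 normr0 mul0r.
- exact: bounded_operator_comp.
Qed.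

End LinearMaps.

(** * Algebra of the q-commutation relation *)

Section DeformedHeisenberg.
Context {K : numFieldType} {H : normedModType K}.
Variables (A B : H -> H) (q : K).
Hypotheses (bA : bounded_operator A) (bB : bounded_operator B).
Hypothesis AB_qBA : forall x, A (B x) = x + q *: B (A x).
Hypothesis q_neq0 : q != 0.
Hypothesis q_not_root1 : forall k, q ^+ k.+1 != 1.

Let C := lie A B.
Let lA : linear A := bA.1.
Let lB : linear B := bB.1.
Let q1 : 1 - q != 0.
Proof. by rewrite subr_eq0 eq_sym (q_not_root1 0). Qed.

Lemma lie_ABE x : C x = x - (1 - q) *: B (A x).
Proof. by rewrite /C lieE AB_qBA scalerBl scale1r opprB addrA. Qed.

Let lC : linear C.
Proof.
move=> a x y; rewrite /C !lieE !lA !lB !lA scalerBr opprD.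
by rewrite addrACA.
Qed.

Let AZ a x : A (a *: x) = a *: A x. Proof. exact: linear_mapZ. Qed.
Let BZ a x : B (a *: x) = a *: B x. Proof. exact: linear_mapZ. Qed.
Let CZ a x : C (a *: x) = a *: C x. Proof. exact: linear_mapZ. Qed.
Let iterBZ l a x : iter l B (a *: x) = a *: iter l B x.
Proof. exact/linear_mapZ/linear_iter. Qed.

(** Together with [ABE]: an adjacent pair of [A] and [B] is affine in [C], and [C] slides past
    either at the cost of powers of [q]. The rewriting of monomials below rests on this. *)
Lemma BAE x : B (A x) = (1 - q)^-1 *: (x - C x).
Proof. by rewrite lie_ABE subKr scalerA mulVf// scale1r. Qed.

Lemma ABE x : A (B x) = (1 - q)^-1 *: (x - q *: C x).
Proof.
apply: (@scalerI _ _ (1 - q)) => //; rewrite scalerA divff// scale1r AB_qBA.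
rewrite scalerDr scalerA (mulrC _ q) -scalerA BAE.
rewrite [(1 - q) *: (_ *: _)]scalerA divff// scale1r.
by rewrite scalerBl scale1r scalerBr addrA subrK.
Qed.

Lemma lie_AB_comm_A x : A (C x) = q *: C (A x).
Proof.
rewrite lie_ABE (linear_mapB A)// AZ ABE scalerA divff// scale1r.
by rewrite subKr.
Qed.

Lemma lie_AB_comm_B x : C (B x) = q *: B (C x).
Proof.
rewrite lie_ABE ABE BZ scalerA divff// scale1r (linear_mapB B)//.
by rewrite BZ subKr.
Qed.

Lemma A_iterC k x : A (iter k C x) = q ^+ k *: iter k C (A x).
Proof.
elim: k => [|k IH] /=; first by rewrite scale1r.
by rewrite lie_AB_comm_A IH CZ scalerA exprS.
Qed.

Lemma iterA_C l x : iter l A (C x) = q ^+ l *: C (iter l A x).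
Proof.
elim: l => [|l IH] /=; first by rewrite scale1r.
by rewrite IH AZ lie_AB_comm_A scalerA exprSr.
Qed.

Lemma iterC_B k x : iter k C (B x) = q ^+ k *: B (iter k C x).
Proof.
elim: k => [|k IH] /=; first by rewrite scale1r.
by rewrite IH CZ lie_AB_comm_B scalerA exprSr.
Qed.

Lemma C_iterB l x : C (iter l B x) = q ^+ l *: iter l B (C x).
Proof.
elim: l => [|l IH] /=; first by rewrite scale1r.
by rewrite lie_AB_comm_B IH BZ scalerA exprS.
Qed.

(** Brings [A] to the left of the powers of [C], where it can meet a [B]. *)
Lemma iterC_A k x : iter k C (A x) = q ^- k *: A (iter k C x).
Proof. by rewrite A_iterC scalerA mulVf ?scale1r// expf_neq0. Qed.

(* The span of the normal-ordered monomials containing a factor [C]: it is the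
   two-sided ideal of the q-deformed Heisenberg algebra generated by [C]. *)
Definition comm_ideal : set (H -> H) := lin_span
  ([set iter k.+1 C \o iter l A | k in setT & l in setT] `|`
   [set iter l B \o iter k.+1 C | k in setT & l in setT]).

Lemma comm_ideal_CA k l : comm_ideal (iter k.+1 C \o iter l A).
Proof. by apply: sub_lin_span; left; exists k => //; exists l. Qed.

Lemma comm_ideal_BC k l : comm_ideal (iter l B \o iter k.+1 C).
Proof. by apply: sub_lin_span; right; exists k => //; exists l. Qed.

Lemma comm_ideal_ind (S : set (H -> H)) :
  S 0 -> (forall a X Y, S X -> S Y -> S (a *: X + Y)) ->
  (forall k l, S (iter k.+1 C \o iter l A)) ->
  (forall k l, S (iter l B \o iter k.+1 C)) -> comm_ideal `<=` S.
Proof.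
move=> S0 SL SCA SBC; apply: lin_span_ind => // X.
by case=> -[k _ [l _ <-]]; [exact: SCA|exact: SBC].
Qed.

Lemma comm_ideal_bounded : comm_ideal `<=` bounded_operator.
Proof.
have [_ b1 /submod_closedP[b0 bL] bM] := @bounded_operator_unital K H.
have b_iter (T : H -> H) k : bounded_operator T -> bounded_operator (iter k T).
  by move=> bT; elim: k => [|k]; [exact: b1|exact: bM].
have bC : bounded_operator C.
  by rewrite /C /lie addrC -scaleN1r; apply: bL; exact: bM.
by apply: comm_ideal_ind => // k l; apply: bM; exact: b_iter.
Qed.

(** Linearity reduces this to monomials. [A] slides through powers of [C]; in front of a [B] it
    merges with it into an affine function of [C], which slides through the remaining powers of
    [B]. *)
Lemma comm_ideal_compA X : comm_ideal X -> comm_ideal (A \o X).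
Proof.
move: X; change (comm_ideal `<=` [set X : H -> H | comm_ideal (A \o X)]).
apply: comm_ideal_ind => /=.
- by rewrite comp0//; exact: lin_span0.
- by move=> a X Y IX IY; rewrite compD//; exact: lin_spanP.
- move=> k l; have -> : A \o (iter k.+1 C \o iter l A) =
      q ^+ k.+1 *: (iter k.+1 C \o iter l.+1 A).
    by apply/funext => x; rewrite !fctE [LHS]A_iterC.
  by apply: lin_spanZ; exact: comm_ideal_CA.
- move=> k [|l].
    (* Without any [B] the product leaves the second family of monomials and falls into the
       first. *)
    have -> : A \o (iter 0 B \o iter k.+1 C) =
        q ^+ k.+1 *: (iter k.+1 C \o iter 1 A).
      by apply/funext => x; rewrite !fctE [LHS]A_iterC.
    by apply: lin_spanZ; exact: comm_ideal_CA.
  have -> : A \o (iter l.+1 B \o iter k.+1 C) = (1 - q)^-1 *: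
      ((iter l B \o iter k.+1 C) - q ^+ l.+1 *: (iter l B \o iter k.+2 C)).
    apply/funext => x; rewrite !fctE [LHS]ABE C_iterB.
    by rewrite scalerA -exprS.
  apply: lin_spanZ; apply: lin_spanB; first exact: comm_ideal_BC.
  by apply: lin_spanZ; exact: comm_ideal_BC.
Qed.

Lemma comm_ideal_compB X : comm_ideal X -> comm_ideal (B \o X).
Proof.
move: X; change (comm_ideal `<=` [set X : H -> H | comm_ideal (B \o X)]).
apply: comm_ideal_ind => /=.
- by rewrite comp0//; exact: lin_span0.
- by move=> a X Y IX IY; rewrite compD//; exact: lin_spanP.
- move=> k [|l]; first exact: (comm_ideal_BC k 1).
  have -> : B \o (iter k.+1 C \o iter l.+1 A) = (q ^- k.+1 / (1 - q)) *:
      ((iter k.+1 C \o iter l A) - (iter k.+2 C \o iter l A)).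
    apply/funext => x; rewrite !fctE [iter l.+1 _ _]/= iterC_A.
    by rewrite BZ BAE scalerA.
  apply: lin_spanZ; apply: lin_spanB; exact: comm_ideal_CA.
- by move=> k l; exact: (comm_ideal_BC k l.+1).
Qed.

Lemma comm_ideal_Acomp X : comm_ideal X -> comm_ideal (X \o A).
Proof.
move: X; change (comm_ideal `<=` [set X : H -> H | comm_ideal (X \o A)]).
apply: comm_ideal_ind => /=.
- exact: lin_span0.
- by move=> a X Y IX IY; exact: lin_spanP.
- move=> k l; have -> : (iter k.+1 C \o iter l A) \o A =
     iter k.+1 C \o iter l.+1 A by apply/funext => x; rewrite !fctE (iterSr l).
  exact: comm_ideal_CA.
- move=> k [|l]; first exact: (comm_ideal_CA k 1).
  have -> : (iter l.+1 B \o iter k.+1 C) \o A = (q ^- k.+1 / (1 - q)) *: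
      ((iter l B \o iter k.+1 C) - (iter l B \o iter k.+2 C)).
    apply/funext => x; rewrite !fctE iterC_A iterSr BZ BAE.
    rewrite !iterBZ.
    by rewrite (linear_mapB (iter l B) _ _ (linear_iter B l lB)) scalerA.
  apply: lin_spanZ; apply: lin_spanB; exact: comm_ideal_BC.
Qed.

Lemma comm_ideal_Bcomp X : comm_ideal X -> comm_ideal (X \o B).
Proof.
move: X; change (comm_ideal `<=` [set X : H -> H | comm_ideal (X \o B)]).
apply: comm_ideal_ind => /=.
- exact: lin_span0.
- by move=> a X Y IX IY; exact: lin_spanP.
- move=> k [|l].
    have -> : (iter k.+1 C \o iter 0 A) \o B =
        q ^+ k.+1 *: (iter 1 B \o iter k.+1 C).
      by apply/funext => x; rewrite !fctE [LHS]iterC_B.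
    by apply: lin_spanZ; exact: comm_ideal_BC.
  have -> : (iter k.+1 C \o iter l.+1 A) \o B = (1 - q)^-1 *:
      ((iter k.+1 C \o iter l A) - q ^+ l.+1 *: (iter k.+2 C \o iter l A)).
    apply/funext => x; rewrite !fctE (iterSr l) ABE.
    rewrite (linear_mapZ (iter l A) _ _ (linear_iter A l lA)).
    rewrite (linear_mapB (iter l A) _ _ (linear_iter A l lA)).
    rewrite (linear_mapZ (iter l A) _ _ (linear_iter A l lA)) iterA_C.
    rewrite scalerA -exprS (linear_mapZ (iter k.+1 C) _ _ (linear_iter C k.+1 lC)).
    rewrite (linear_mapB (iter k.+1 C) _ _ (linear_iter C k.+1 lC)).
    by rewrite (linear_mapZ (iter k.+1 C) _ _ (linear_iter C k.+1 lC)) -iterSr.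
  apply: lin_spanZ; apply: lin_spanB; first exact: comm_ideal_CA.
  by apply: lin_spanZ; exact: comm_ideal_CA.
- move=> k l; have -> : (iter l B \o iter k.+1 C) \o B =
      q ^+ k.+1 *: (iter l.+1 B \o iter k.+1 C).
    apply/funext => x; rewrite !fctE iterC_B.
    by rewrite iterBZ -iterSr.
  by apply: lin_spanZ; exact: comm_ideal_BC.
Qed.

(** * The generated algebra and its two-sided ideal *)

Lemma heisenberg_unital : unital_subalgebra (heisenberg_algebra A B).
Proof.
split.
- apply: smallest_sub; first exact: bounded_operator_unital.
  by move=> X [->|->].
- by move=> S [[]].
- apply/submod_closedP; split; first by move=> S [[_ _ /submod_closedP[]]].
  move=> a X Y hX hY S SP; have [_ _ /submod_closedP[_ SL] _] := SP.1.
  by apply: SL; [exact: hX|exact: hY].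
- move=> X Y hX hY S SP; have [_ _ _ SM] := SP.1.
  by apply: SM; [exact: hX|exact: hY].
Qed.

Lemma heisenberg_generators : heisenberg_algebra A B A /\ heisenberg_algebra A B B.
Proof.
by split=> S [_ GS]; apply: GS; [left|right].
Qed.

Let heisC : heisenberg_algebra A B C.
Proof.
have [_ _ /submod_closedP[_ hL] hM] := heisenberg_unital.
have [hA hB] := heisenberg_generators.
by rewrite /C /lie addrC -scaleN1r; apply: hL; exact: hM.
Qed.

Let heis_iter T k : heisenberg_algebra A B T -> heisenberg_algebra A B (iter k T).
Proof.
have [_ h1 _ hM] := heisenberg_unital.
by move=> hT; elim: k => [|k]; [exact: h1|exact: hM].
Qed.

Lemma comm_ideal_heisenberg : comm_ideal `<=` heisenberg_algebra A B.
Proof.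
have [_ h1 /submod_closedP[h0 hL] hM] := heisenberg_unital.
have [hA hB] := heisenberg_generators.
by apply: comm_ideal_ind => // k l; apply: hM; exact: heis_iter.
Qed.

Lemma L0_heisenberg : L0 A B `<=` heisenberg_algebra A B.
Proof.
have [_ h1 /submod_closedP[h0 hL] hM] := heisenberg_unital.
have [hA hB] := heisenberg_generators.
apply: lin_span_ind => // X [[[[->|->]|[k _ <-]]|[k _ [l _ <-]]]|[k _ [l _ <-]]] //;
  by [exact: heis_iter|apply: hM; exact: heis_iter].
Qed.

(** The bounded operators preserving the ideal from both sides form a unital subalgebra containing
    [A] and [B]; minimality of the generated algebra concludes. *)
Lemma comm_ideal_two_sided X Y : heisenberg_algebra A B X -> comm_ideal Y ->
  comm_ideal (X \o Y) /\ comm_ideal (Y \o X).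
Proof.
move=> hX; move: X hX Y.
pose S : set (H -> H) := [set X | bounded_operator X /\
  forall Y, comm_ideal Y -> comm_ideal (X \o Y) /\ comm_ideal (Y \o X)].
suff: heisenberg_algebra A B `<=` S by move=> hS X /hS[].
have [_ b1 /submod_closedP[b0 bL] bM] := @bounded_operator_unital K H.
apply: smallest_sub; first split.
- by move=> X [].
- by [].
- apply/submod_closedP; split.
    split=> // Y IY; split; first exact: lin_span0.
    by rewrite comp0; [exact: lin_span0|exact: (comm_ideal_bounded _ IY).1].
  move=> a X Y [bX IX] [bY IY]; split=> [|Z IZ]; first exact: bL.
  rewrite (compD Z); last exact: (comm_ideal_bounded _ IZ).1.
  by split; apply: lin_spanP; by [exact: (IX _ IZ).1|exact: (IY _ IZ).1|
    exact: (IX _ IZ).2|exact: (IY _ IZ).2].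
- move=> X Y [bX IX] [bY IY]; split=> [|Z IZ]; first exact: bM.
  by split; [exact: (IX _ (IY _ IZ).1).1|exact: (IY _ (IX _ IZ).2).2].
- move=> X [->|->]; split=> // Y IY.
    by split; [exact: comm_ideal_compA|exact: comm_ideal_Acomp].
  by split; [exact: comm_ideal_compB|exact: comm_ideal_Bcomp].
Qed.

Lemma comm_ideal_lie X Y : heisenberg_algebra A B X -> comm_ideal Y ->
  comm_ideal (lie X Y) /\ comm_ideal (lie Y X).
Proof.
move=> hX IY; have [XY YX] := comm_ideal_two_sided X Y hX IY.
by split; apply: lin_spanB.
Qed.

(** * The derived algebra of [L0 A B] as the ideal *)

Lemma comm_ideal_L0 : comm_ideal `<=` L0 A B.
Proof.
apply: comm_ideal_ind; [exact: lin_span0|by move=> *; exact: lin_spanP| |].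
- move=> k [|l]; apply: sub_lin_span; first by left; left; right; exists k.+1.
  by left; right; exists k.+1 => //; exists l.+1.
- move=> k [|l]; apply: sub_lin_span; first by left; left; right; exists k.+1.
  by right; exists k.+1 => //; exists l.+1.
Qed.

Lemma derived_L0_sub : derived_algebra (L0 A B) `<=` comm_ideal.
Proof.
apply: lin_span_ind; [exact: lin_span0|by move=> *; exact: lin_spanP|].
move=> _ [X L0X [Y L0Y <-]].
have bL0 Z : L0 A B Z -> linear Z.
  have [hb _ _ _] := heisenberg_unital.
  by move=> /L0_heisenberg/hb[].
have lieCs Z W : lie Z W = - lie W Z by rewrite /lie opprB.
pose pos := [set k : nat | (0 < k)%N].
have genP Z : ([set A; B] `|` [set iter k C | k in pos]
    `|` [set iter k C \o iter l A | k in pos & l in pos]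
    `|` [set iter l B \o iter k C | k in pos & l in pos]) Z ->
    Z = A \/ Z = B \/ comm_ideal Z.
  move=> [[[[->|->]|[[|k]//= _ <-]]|[[|k]//= _ [l _ <-]]]|[[|k]//= _ [l _ <-]]].
  - by left.
  - by right; left.
  - by right; right; exact: (comm_ideal_CA k 0).
  - by right; right; exact: comm_ideal_CA.
  - by right; right; exact: comm_ideal_BC.
(* Linearity in the second argument needs [Z] linear; linearity in the first is deduced from it by
   the antisymmetry [lieCs]. *)
have lieL Z W W' a : linear Z -> lie Z (a *: W + W') = a *: lie Z W + lie Z W'.
  move=> lZ; apply/funext => x; rewrite !fctE !lieE /= lZ.
  by rewrite scalerBr opprD addrACA.
move: X L0X.
(* Two nested span inductions: first on [X], then on [Y] when [X] is [A] or [B]. *)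
suff: L0 A B `<=` [set X : H -> H | comm_ideal (lie X Y)] by [].
apply: lin_span_ind => /=.
- by rewrite /lie comp0 ?subr0; [exact: lin_span0|exact: bL0].
- move=> a X X' IX IX'; rewrite lieCs lieL; last exact: bL0.
  rewrite opprD -scalerN -!lieCs; exact: lin_spanP.
move=> X GX; have L0X : L0 A B X by exact: sub_lin_span.
have hX := L0_heisenberg _ L0X.
have [XA|[XB|IX]] := genP X GX;
  last by have [] := comm_ideal_lie Y X (L0_heisenberg _ L0Y) IX.
all: move: Y L0Y; suff: L0 A B `<=` [set Y : H -> H | comm_ideal (lie X Y)] by [].
all: apply: lin_span_ind => /=; first by
  rewrite /lie comp0 ?subr0; [exact: lin_span0|exact: bL0].
all: try by move=> a Y Y' IY IY'; rewrite lieL; [exact: lin_spanP|exact: bL0].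
all: move=> Y /genP[YA|[YB|IY]]; last by have [] := comm_ideal_lie X Y hX IY.
- by rewrite XA YA /= /lie subrr; exact: lin_span0.
- by rewrite XA YB; exact: (comm_ideal_CA 0 0).
- rewrite XB YA /= lieCs -scaleN1r; apply: lin_spanZ.
  exact: (comm_ideal_CA 0 0).
- by rewrite XB YB /= /lie subrr; exact: lin_span0.
Qed.

Lemma comm_ideal_derived : comm_ideal `<=` derived_algebra (L0 A B).
Proof.
have [L0A L0B] : L0 A B A /\ L0 A B B.
  by split; apply: sub_lin_span; left; left; left; [left|right].
have L0CA k l : L0 A B (iter k.+1 C \o iter l A).
  by apply: comm_ideal_L0; exact: comm_ideal_CA.
have L0BC k l : L0 A B (iter l B \o iter k.+1 C).
  by apply: comm_ideal_L0; exact: comm_ideal_BC.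
have Dlie X Y : L0 A B X -> L0 A B Y -> derived_algebra (L0 A B) (lie X Y).
  by move=> L0X L0Y; apply: sub_lin_span; exists X => //; exists Y.
have q1k k : 1 - q ^+ k.+1 != 0 by rewrite subr_eq0 eq_sym q_not_root1.
have DC k : derived_algebra (L0 A B) (iter k.+1 C).
  elim: k => [|k IH]; first exact: Dlie.
  (* [c] is the coefficient of [C ^ (k+2)] in the bracket of [A] with [B C ^ (k+1)]; its vanishing
     would mean [q ^ (k+2) = 1]. *)
  pose c := (1 - q)^-1 * (q ^- k.+1 - q).
  have c0 : c != 0.
    rewrite mulf_neq0 ?invr_eq0// subr_eq0 -(inj_eq (mulIf (expf_neq0 k.+1 q_neq0))).
    by rewrite mulVf ?expf_neq0// -exprS eq_sym q_not_root1.
  have -> : iter k.+2 C = c^-1 *: (lie A (B \o iter k.+1 C) -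
      ((1 - q)^-1 * (1 - q ^- k.+1)) *: iter k.+1 C).
    apply/funext => x; set u := iter k.+2 C x.
    rewrite -[RHS]/(c^-1 *: (lie A (B \o iter k.+1 C) x -
      ((1 - q)^-1 * (1 - q ^- k.+1)) *: iter k.+1 C x)).
    set v := iter k.+1 C x.
    have -> : lie A (B \o iter k.+1 C) x =
        (1 - q)^-1 *: (v - q *: u) - ((1 - q)^-1 * q ^- k.+1) *: (v - u).
      rewrite lieE -[X in X - _]/(A (B v)) -[X in _ - X]/(B (iter k.+1 C (A x))).
      by rewrite ABE iterC_A BZ BAE scalerA [q ^- _ * _]mulrC.
    apply: (@scalerI _ _ c) => //; rewrite scalerA divff// scale1r /c.
    rewrite -!scalerA; move: u v => u v; rewrite -!scalerBr; congr (_ *: _).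
    rewrite !scalerBl scalerBr scale1r !opprB -addrA [X in _ = _ + X]addrA subrK.
    by rewrite [RHS]addrC addrA subrK.
  apply: lin_spanZ; apply: lin_spanB; first by apply: Dlie => //; exact: (L0BC k 1).
  exact: lin_spanZ.
apply: comm_ideal_ind; [exact: lin_span0|by move=> *; exact: lin_spanP| |].
- move=> k [|l]; first exact: DC.
  (* No induction on [l] is needed, since the shorter monomial already lies in [L0 A B]. *)
  have -> : iter k.+1 C \o iter l.+1 A =
      (1 - q ^+ k.+1)^-1 *: lie (iter k.+1 C \o iter l A) A.
    apply/funext => x; rewrite -[RHS]/((1 - q ^+ k.+1)^-1 *:
      (iter k.+1 C (iter l A (A x)) - A (iter k.+1 C (iter l A x)))).
    rewrite A_iterC -iterSr -iterS -[LHS]/(iter k.+1 C (iter l.+1 A x)).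
    by rewrite -{2}[iter k.+1 C _]scale1r -scalerBl scalerA mulVf// scale1r.
  by apply: lin_spanZ; exact: Dlie.
- move=> k [|l]; first exact: DC.
  have -> : iter l.+1 B \o iter k.+1 C =
      (1 - q ^+ k.+1)^-1 *: lie B (iter l B \o iter k.+1 C).
    apply/funext => x; rewrite -[RHS]/((1 - q ^+ k.+1)^-1 *:
      (iter l.+1 B (iter k.+1 C x) - iter l B (iter k.+1 C (B x)))).
    rewrite iterC_B iterBZ -iterSr -[LHS]/(iter l.+1 B (iter k.+1 C x)).
    by rewrite -{2}[iter l.+1 B _]scale1r -scalerBl scalerA mulVf// scale1r.
  by apply: lin_spanZ; exact: Dlie.
Qed.

(* Graded by the number of levels by which the operator lowers: [Posz l] is
   [A ^ l] and [Negz l], that is [- (l + 1)], is [B ^ (l + 1)]. *)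
Definition ladder (m : int) : H -> H :=
  match m with Posz l => iter l A | Negz l => iter l.+1 B end.

(** Products of two such sums are never expanded: the set of these sums contains the identity and is
    stable under left multiplication by [A] and [B], hence by the whole algebra. *)
Lemma heisenberg_ladder X : heisenberg_algebra A B X ->
  exists Y Z, [/\ lin_span (range ladder) Y, comm_ideal Z & X = Y + Z].
Proof.
pose S : set (H -> H) := [set X | exists Y Z,
  [/\ lin_span (range ladder) Y, comm_ideal Z & X = Y + Z]].
have S0 : S 0 by exists 0, 0; rewrite addr0; split=> //; exact: lin_span0.
have SL a X1 X2 : S X1 -> S X2 -> S (a *: X1 + X2).
  move=> [Y1 [Z1 [PY1 IZ1 ->]]] [Y2 [Z2 [PY2 IZ2 ->]]].
  exists (a *: Y1 + Y2), (a *: Z1 + Z2); rewrite scalerDr addrACA.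
  by split=> //; exact: lin_spanP.
have SZ a X1 : S X1 -> S (a *: X1).
  by move=> SX; rewrite -[a *: X1]addr0; exact: SL.
have SB X1 X2 : S X1 -> S X2 -> S (X1 - X2).
  by move=> SX1 SX2; rewrite addrC -scaleN1r; exact: SL.
have Sladder m : S (ladder m).
  exists (ladder m), 0; rewrite addr0; split=> //; last exact: lin_span0.
  by apply: sub_lin_span; exists m.
have SI Z : comm_ideal Z -> S Z.
  by move=> IZ; exists 0, Z; rewrite add0r; split=> //; exact: lin_span0.
have SA X1 : S X1 -> S (A \o X1).
  move=> [Y [Z [PY IZ ->]]]; rewrite -[Y]scale1r compD//; apply: (SL); last first.
    by apply: (SI); exact: comm_ideal_compA.
  move: Y PY; change (lin_span (range ladder) `<=` [set Y : H -> H | S (A \o Y)]).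
  apply: lin_span_ind => /=.
  - by rewrite comp0.
  - by move=> a Y Y' ? ?; rewrite compD//; exact: SL.
  - move=> _ [[l|l] _ <-]; first exact: (Sladder l.+1).
    rewrite /mkset; have -> : A \o ladder (Negz l) = (1 - q)^-1 *:
        (iter l B - q ^+ l.+1 *: (iter l B \o iter 1 C)).
      by apply/funext => x; rewrite !fctE [LHS]ABE C_iterB scalerA -exprS.
    apply: (SZ); apply: (SB); last by apply: (SZ); apply: (SI); exact: comm_ideal_BC.
    (* [B ^ 0] is the identity, indexed by [Posz 0]; only positive powers of [B] are indexed by
       [Negz]. *)
    by case: l => [|l]; [exact: (Sladder 0)|exact: (Sladder (Negz l))].
have SBc X1 : S X1 -> S (B \o X1).
  move=> [Y [Z [PY IZ ->]]]; rewrite -[Y]scale1r compD//; apply: (SL); last first.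
    by apply: (SI); exact: comm_ideal_compB.
  move: Y PY; change (lin_span (range ladder) `<=` [set Y : H -> H | S (B \o Y)]).
  apply: lin_span_ind => /=.
  - by rewrite comp0.
  - by move=> a Y Y' ? ?; rewrite compD//; exact: SL.
  - move=> _ [[[|l]|l] _ <-].
    + exact: (Sladder (Negz 0)).
    + rewrite /mkset; have -> : B \o ladder l.+1 =
        (1 - q)^-1 *: (iter l A - (iter 1 C \o iter l A)).
        by apply/funext => x; rewrite !fctE [LHS]BAE.
      by apply: (SZ); apply: (SB); [exact: (Sladder l)|apply: (SI); exact: comm_ideal_CA].
    + exact: (Sladder (Negz l.+1)).
(* The operators stabilizing [S] form a unital subalgebra; applying [X] to the identity, which is in
   [S], recovers [X]. *)
suff: heisenberg_algebra A B `<=` [set X | bounded_operator X /\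
    forall Y, S Y -> S (X \o Y)].
  by move=> hS /hS[_ /(_ id)]; apply; exact: (Sladder 0).
have [_ b1 /submod_closedP[b0 bL] bM] := @bounded_operator_unital K H.
apply: smallest_sub; first split.
- by move=> ? [].
- by [].
- apply/submod_closedP; split=> [|a X1 X2 [bX1 SX1] [bX2 SX2]]; first by split.
  by split=> [|Y SY]; [exact: bL|apply: SL; [exact: SX1|exact: SX2]].
- move=> X1 X2 [bX1 SX1] [bX2 SX2].
  by split=> [|Y SY]; [exact: bM|exact: (SX1 _ (SX2 _ SY))].
- by move=> X1 [->|->].
Qed.

End DeformedHeisenberg.

(** * Compact operators *)

Section CompactOperators.
Context {K : numFieldType}.

Lemma totally_bounded_lipschitz {V W : normedModType K} (f : V -> W) (M : K)
    (S : set V) : 0 < M -> (forall x y, `|f x - f y| <= M * `|x - y|) ->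
  totally_bounded S -> totally_bounded (f @` S).
Proof.
move=> M0 fM bS e e0; have [F FS] := bS _ (divr_gt0 e0 M0).
exists (map f F) => _ [x /FS[y yF xy] <-]; exists (f y); first exact: map_f.
by rewrite (le_lt_trans (fM _ _))// mulrC -ltr_pdivlMr.
Qed.

Context {H : completeNormedModType K}.
Implicit Types (X Y T : H -> H).

Local Notation unit_ball := [set x : H | `|x| <= 1].

Lemma compact_operatorE T :
  compact_operator T <-> linear T /\ totally_bounded (T @` unit_ball).
Proof.
split=> -[lT cT]; split=> //; first exact: precompact_totally_bounded.
exact: totally_bounded_precompact.
Qed.

Lemma compact_operator0 : compact_operator (0 : H -> H).
Proof.
apply/compact_operatorE; split.
  by move=> a x y; rewrite -[LHS]/0 -[RHS]/(a *: 0 + 0) scaler0 addr0.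
move=> e e0; exists [:: 0] => _ [x _ <-]; exists 0; first by rewrite inE.
by rewrite -[X in X - _]/0 subrr normr0.
Qed.

Lemma compact_operatorP a X Y : compact_operator X -> compact_operator Y ->
  compact_operator (a *: X + Y).
Proof.
move=> /compact_operatorE[lX bX] /compact_operatorE[lY bY].
apply/compact_operatorE; split.
  move=> b x y; rewrite -[LHS]/(a *: X (b *: x + y) + Y (b *: x + y)).
  rewrite -[RHS]/(b *: (a *: X x + Y x) + (a *: X y + Y y)) lX lY !scalerDr.
  by rewrite !scalerA (mulrC a) -!addrA; congr (_ + _); rewrite addrCA.
apply: (totally_boundedS _ _ _ (totally_boundedD _ _
  (totally_bounded_lipschitz (fun x => a *: x) (`|a| + 1) _ _ _ bX) bY)).
- by move=> _ [x x1 <-]; exists (a *: X x);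
    [exists (X x) => //; exists x|exists (Y x) => //; exists x].
- by rewrite ltr_wpDl.
- by move=> x y; rewrite -scalerBr normrZ ler_wpM2r// lerDl.
Qed.

Lemma compact_operator_compl X Y : bounded_operator X -> compact_operator Y ->
  compact_operator (X \o Y).
Proof.
move=> bX /compact_operatorE[lY bY]; have [M M0 XM] := bounded_operator_gt0 X bX.
apply/compact_operatorE; split; first by move=> a x y /=; rewrite lY bX.1.
rewrite -image_comp; apply: (totally_bounded_lipschitz _ M) => // x y.
by rewrite -(linear_mapB X)//; exact: bX.1.
Qed.

(** [Y] sends the unit ball into the ball of radius [M], so [X \o Y] sends it into [M] times the
    totally bounded image of the unit ball under [X]. *)
Lemma compact_operator_compr X Y : compact_operator X -> bounded_operator Y ->
  compact_operator (X \o Y).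
Proof.
move=> /compact_operatorE[lX bX] bY; have [M M0 YM] := bounded_operator_gt0 Y bY.
apply/compact_operatorE; split; first by move=> a x y /=; rewrite bY.1 lX.
apply: (totally_boundedS _ _ _
  (totally_bounded_lipschitz (fun x => M *: x) M _ M0 _ bX)); last first.
  by move=> x y; rewrite -scalerBr normrZ gtr0_norm.
move=> _ [x x1 <-]; exists (X (M^-1 *: Y x)).
  exists (M^-1 *: Y x) => //=; rewrite normrZ gtr0_norm ?invr_gt0//.
  rewrite mulrC ler_pdivrMr// mul1r (le_trans (YM _))//.
  by rewrite ler_piMr// ltW.
by rewrite (linear_mapZ X)// scalerA divff ?gt_eqF// scale1r.
Qed.

Lemma compact_comm_ideal (A B : H -> H) : bounded_operator A -> bounded_operator B ->
  compact_operator (lie A B) -> comm_ideal A B `<=` compact_operator.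
Proof.
move=> bA bB cC; have [_ b1 /submod_closedP[b0 bL] bM] := @bounded_operator_unital K H.
have b_iter (T : H -> H) k : bounded_operator T -> bounded_operator (iter k T).
  by move=> bT; elim: k => [|k]; [exact: b1|exact: bM].
have cCk k : compact_operator (iter k.+1 (lie A B)).
  elim: k => [|k IH]; first exact: cC.
  apply: (compact_operator_compr (lie A B) (iter k.+1 (lie A B))) => //.
  apply: b_iter; rewrite /lie addrC -scaleN1r; apply: bL; exact: bM.
apply: comm_ideal_ind => [|a X Y|k l|k l].
- exact: compact_operator0.
- exact: compact_operatorP.
- by apply: compact_operator_compr => //; exact: b_iter.
- by apply: compact_operator_compl => //; exact: b_iter.
Qed.

End CompactOperators.

(** * The representation on a Hilbert space *)

Section HilbertSpace.
Context {R : realType} {H : completeNormedModType R[i]}.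
Local Notation K := R[i].
Local Open Scope complex_scope.
Variables (ip : {dot H for Num.conj}) (Phi : nat -> H).
Hypotheses (hip : hilbert_norm ip) (hPhi : complete_orthonormal ip Phi).

(** Comparable elements of [R[i]] share their imaginary part, so a positive one is real. *)
Lemma complex_gt0P (e : K) : 0 < e -> exists2 r : R, 0 < r & e = r%:C.
Proof. by case: e => a b; rewrite ltcE/= => /andP[/eqP-> a0]; exists a. Qed.

Lemma norm_realC (x : R) : `|x%:C| = `|x|%:C :> K.
Proof. by rewrite normc_def /= expr0n addr0 sqrtr_sqr. Qed.

Lemma norm_imaginary : `|'i| = 1 :> K.
Proof. by rewrite normc_def /= expr0n expr1n add0r sqrtr1. Qed.

(** The disk lies in a square, the sum of the real segment [[-1, 1]] and of its multiple by ['i]. *)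
Lemma totally_bounded_unit_disk : totally_bounded [set z : K^o | `|z| <= 1].
Proof.
have bI : totally_bounded [set (x%:C : K^o) | x in `[-1, 1]%classic : set R].
  move=> e /complex_gt0P[r r0 ->].
  have : totally_bounded (`[-1, 1]%classic : set R^o).
    apply: precompact_totally_bounded; apply: compact_precompact.
      exact: norm_hausdorff.
    exact: segment_compact.
  move=> /(_ r r0)[F FS].
  exists [seq (x%:C : K^o) | x <- F] => _ [x /FS[y yF xy] <-].
  exists y%:C; first exact: map_f.
  by rewrite -rmorphB/= norm_realC ltcR.
apply: (totally_boundedS _ _ _ (totally_boundedD _ _ bI
  (totally_bounded_lipschitz (fun z : K^o => 'i * z : K^o) 1 _ _ _ bI))) => //.
- move=> z /= z1.
  have zRe w : `|w| <= 1 :> K -> `[-1, 1]%classic (complex.Re w).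
    move=> w1; rewrite /= in_itv/= -ler_norml -lecR.
    exact: le_trans (normc_ge_Re w) w1.
  exists (complex.Re z)%:C; first by exists (complex.Re z) => //; exact: zRe.
  (* The imaginary part is written as minus the real part of ['i * z], so that [zRe] bounds it
     too. *)
  exists ('i * (- complex.Re ('i * z))%:C); last by case: z {z1} => a b; simpc.
  exists (- complex.Re ('i * z))%:C => //; exists (- complex.Re ('i * z)) => //.
  have := zRe ('i * z); rewrite normrM norm_imaginary mul1r => /(_ z1).
  by rewrite /= !in_itv/= lerN2 lerNl andbC.
- by move=> x y; rewrite -mulrBr normrM norm_imaginary.
Qed.

Lemma totally_bounded_scale (v : H) (r : K) : 0 < r ->
  totally_bounded [set a *: v | a in [set a : K^o | `|a| <= r]].
Proof.
move=> r0; apply: (totally_boundedS _ _ _ (totally_bounded_lipschitz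
  (fun a : K^o => (r * a) *: v) (r * (`|v| + 1)) _ _ _ totally_bounded_unit_disk)).
- move=> _ [a /= ar <-]; exists (r^-1 * a); last by rewrite mulVKf ?gt_eqF.
  by rewrite /= normrM gtr0_norm ?invr_gt0// mulrC ler_pdivrMr// mul1r.
- by rewrite mulr_gt0// ltr_wpDl.
- move=> x y; rewrite -scalerBl -mulrBr normrZ normrM (gtr0_norm r0) -!mulrA.
  by rewrite ler_pM2l// mulrC ler_wpM2r// lerDl.
Qed.

Lemma ip_suml (I : Type) (s : seq I) (c : I -> K) (f : I -> H) v :
  ip (\sum_(i <- s) c i *: f i) v = \sum_(i <- s) c i * ip (f i) v.
Proof.
elim: s => [|i s IH]; first by rewrite !big_nil linear0l.
by rewrite !big_cons linearDl linearZl_LR /= IH.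
Qed.

Lemma Phi_norm n : `|Phi n| = 1.
Proof.
apply/eqP; rewrite -(@eqrXn2 _ 2)//.
by rewrite -hip hPhi.1 eqxx expr1n.
Qed.

(** One-term Bessel inequality: [x] splits orthogonally into [a *: Phi n] and [y], and Pythagoras
    applies. *)
Lemma ip_Phi_le x n : `|ip x (Phi n)| <= `|x|.
Proof.
pose a := ip x (Phi n); pose y := x - a *: Phi n.
have Phi1 : ip (Phi n) (Phi n) = 1 by rewrite hPhi.1 eqxx.
have yo : ip y (a *: Phi n) = 0.
  by rewrite linearZr_LR /= linearBl linearZl_LR /= Phi1 mulr1 subrr mulr0.
have xE : ip x x = ip y y + `|a| ^+ 2.
  by rewrite -{1 2}[x](subrK (a *: Phi n)) -/y hnormDd//; congr (_ + _);
    apply: etrans (hip (a *: Phi n)) _; rewrite normrZ Phi_norm mulr1.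
rewrite -/a -(@ler_pXn2r _ 2)// ?nnegrE// -(hip x) xE lerDr hip exprn_ge0//.
Qed.

Lemma Phi_dense x (e : K) : 0 < e -> exists2 y, lin_span (range Phi) y & `|x - y| < e.
Proof.
move=> e0; have : closure (lin_span (range Phi)) x by rewrite hPhi.2.
move=> /(_ _ (nbhsx_ballx x e e0))[y [Sy]].
by rewrite -ball_normE /=; exists y.
Qed.

(** Any [N] past the finitely many indices involved works; this freedom later allows a split into
    head and tail. *)
Lemma lin_span_Phi y : lin_span (range Phi) y ->
  exists M, forall N, (M <= N)%N -> y = \sum_(n < N) ip y (Phi n) *: Phi n.
Proof.
move=> /lin_span_sum_uniq[s [c [us ->]]].
exists (\max_(n <- s) n.+1)%N => N MN.
have coef n : ip (\sum_(i <- s) c i *: Phi i) (Phi n) = if n \in s then c n else 0.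
  rewrite ip_suml; case: ifPn => ns.
    rewrite (bigD1_seq n)//= hPhi.1 eqxx mulr1 big1 ?addr0// => i /negbTE ni.
    by rewrite hPhi.1 ni mulr0.
  rewrite big_seq big1// => i si; rewrite hPhi.1; case: eqP => [ei|]; rewrite ?mulr0//.
  by rewrite -ei si in ns.
rewrite -(big_mkord xpredT (fun n => ip _ (Phi n) *: Phi n)).
under [RHS]eq_bigr do rewrite coef (fun_if (fun x => x *: _)) scale0r.
rewrite -big_mkcond -big_filter; apply: perm_big; apply: uniq_perm => //.
  by rewrite filter_uniq// iota_uniq.
move=> n; rewrite mem_filter mem_index_iota /=; case ns: (n \in s) => //=.
by rewrite (leq_trans _ MN)// (bigD1_seq n)//= leq_maxl.
Qed.

(** The difference vanishes on the span of [Phi]; a nonzero value at [x] would contradict its bound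
    at a point of the span close to [x]. *)
Lemma bounded_operator_ext (X Y : H -> H) :
  bounded_operator X -> bounded_operator Y ->
  (forall n, X (Phi n) = Y (Phi n)) -> X = Y.
Proof.
move=> bX bY XY; pose D := (-1 : K) *: X + Y.
have bD : bounded_operator D by exact: bounded_operatorP.
have [M M0 DM] := bounded_operator_gt0 D bD.
apply/funext => x; apply/esym/eqP; rewrite -subr_eq0; apply/eqP.
have -> : Y x - X x = D x by rewrite /D !fctE scaleN1r addrC.
apply/eqP; rewrite -normr_eq0; apply: contraT => Dx.
have Dx0 : 0 < `|D x| by rewrite lt_def Dx normr_ge0.
have [y /lin_span_Phi[N /(_ N (leqnn _)) yE] xy] := Phi_dense x _ (divr_gt0 Dx0 M0).
have Dy : D y = 0.
  rewrite yE (linear_map_sum D)//; last exact: bD.1.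
  by rewrite big1// => n _; rewrite /D !fctE XY scaleN1r addNr scaler0.
suff : `|D x| < `|D x| by rewrite ltxx.
rewrite -{1}[D x]subr0 -Dy -(linear_mapB D); last exact: bD.1.
by rewrite (le_lt_trans (DM _))// mulrC -ltr_pdivlMr.
Qed.

Lemma exprn_small (q : R) (e : K) : 0 < q < 1 -> 0 < e ->
  exists N, (q ^+ N)%:C < e.
Proof.
move=> /andP[q0 q1] /complex_gt0P[r r0 ->].
have : (fun n => q ^+ n) @ \oo --> (0 : R) by apply: cvg_expr; rewrite gtr0_norm.
move=> /cvgr0Pnorm_lt/(_ r r0)[N _ /(_ N (leqnn N)) qN].
by exists N; rewrite ltcR (le_lt_trans (ler_norm _)).
Qed.

Lemma totally_bounded_span N (r : K) : 0 < r -> totally_bounded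
  [set \sum_(n < N) c n *: Phi n | c in [set c : nat -> K | forall n, `|c n| <= r]].
Proof.
move=> r0; elim: N => [|N IH].
  move=> e e0; exists [:: 0] => _ [c _ <-]; exists 0; first by rewrite inE.
  by rewrite big_ord0 subrr normr0.
apply: (totally_boundedS _ _ _ (totally_boundedD _ _ IH
  (totally_bounded_scale (Phi N) _ r0))).
move=> _ [c cr <-]; exists (\sum_(n < N) c n *: Phi n); first by exists c.
by exists (c N *: Phi N); [exists (c N) => //; exact: cr|rewrite big_ord_recr].
Qed.

(* On the dense span of [Phi], [C] is within a geometric tail of its truncation
   to the first [N] basis vectors, whose image of a ball is totally bounded. *)
Lemma compact_diagonal (q : R) (C : H -> H) : 0 < q < 1 -> bounded_operator C ->
  (forall n, C (Phi n) = (q ^+ n)%:C *: Phi n) -> compact_operator C.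
Proof.
move=> q01 bC CPhi; apply/compact_operatorE; split; first exact: bC.1.
have [q0 q1] := andP q01.
have qC0 n : 0 <= (q ^+ n)%:C :> K by rewrite lecR exprn_ge0// ltW.
have [M M0 CM] := bounded_operator_gt0 C bC.
apply: totally_bounded_approx => e e0.
have e20 : 0 < e / 2 by rewrite divr_gt0.
(* The tail beyond [N] will be at most [q ^ N * 2 / (1 - q)], which this choice makes less than
   [e / 2]. *)
have [N qN] : exists N, (q ^+ N)%:C < e / 2 * (1 - q%:C) / 2.
  by apply: exprn_small => //; rewrite divr_gt0// mulr_gt0// subr_gt0 ltcR.
exists [set \sum_(n < N) c n *: Phi n | c in [set c : nat -> K | forall n, `|c n| <= 2]];
  first exact: totally_bounded_span.
move=> _ [x /= x1 <-].
(* [d] is the allowed distance from [x] to a finite combination: [d <= 1] keeps the norm of the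
   latter at most 2, and [M * d <= e / 2] controls the images. With [t = e / 2 / M], the value
   [t / (1 + t)] meets both. *)
have [d [d0 d1 dM]] : exists d : K, [/\ 0 < d, d <= 1 & M * d <= e / 2].
  have u0 : 0 < e / 2 / M by rewrite divr_gt0.
  have u1 : 0 < 1 + e / 2 / M by rewrite addr_gt0.
  exists (e / 2 / M / (1 + e / 2 / M)); split; first by rewrite divr_gt0.
    by rewrite ler_pdivrMr// mul1r lerDr.
  rewrite mulrC -ler_pdivlMr// ler_pdivrMr// ler_peMr//; first exact: ltW.
  by rewrite lerDl ltW.
have [y Sy xy] := Phi_dense x d d0.
have y2 : `|y| <= 2.
  rewrite -[y](subrK x) (le_trans (ler_normD _ _))// [2]splitr -[2 / 2]/(_)%R.
  by rewrite divff ?pnatr_eq0// lerD// distrC (le_trans (ltW xy)).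
pose c n := (q ^+ n)%:C * ip y (Phi n).
have c2 n : `|c n| <= 2.
  rewrite normrM ger0_norm// (le_trans _ y2)// (le_trans _ (ip_Phi_le y n))//.
  by rewrite ler_piMl// lecR exprn_ile1// ltW.
exists (\sum_(n < N) c n *: Phi n); first by exists c.
(* With [N + P] terms, the first [N] terms of [C y] are the truncation and the last [P] the tail. *)
have [P /(_ (N + P)%N (leq_addl _ _)) yE] := lin_span_Phi y Sy.
have Cy : C y = \sum_(n < N + P) c n *: Phi n.
  rewrite {1}yE (linear_map_sum C)//; last exact: bC.1.
  by apply: eq_bigr => n _; rewrite CPhi scalerA mulrC.
rewrite (le_lt_trans (ler_distD (C y) _ _))// [e]splitr ler_ltD//.
  rewrite -(linear_mapB C); last exact: bC.1.
  by rewrite (le_trans (CM _))// (le_trans _ dM)// ler_pM2l// ltW.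
rewrite Cy big_split_ord/= addrAC subrr add0r.
rewrite (le_lt_trans (ler_norm_sum _ _ _))//.
apply: (@le_lt_trans _ _ (\sum_(i < P) (q ^+ N)%:C * (q ^+ i)%:C * 2)).
  apply: ler_sum => i _; rewrite normrZ Phi_norm mulr1 /c normrM ger0_norm//.
  by rewrite exprD rmorphM/= ler_wpM2l ?mulr_ge0// (le_trans (ip_Phi_le _ _)).
rewrite -mulr_suml -mulr_sumr.
have geom : (\sum_(i < P) (q ^+ i)%:C) * (1 - q%:C) <= 1 :> K.
  rewrite -(rmorph_sum (real_complex R)) -(rmorph1 (real_complex R)) -rmorphB -rmorphM.
  rewrite lecR -[leLHS]opprK -mulrN opprB mulrC -subrX1 opprB lerBlDr lerDl.
  by rewrite exprn_ge0// ltW.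
have D0 : 0 < 1 - q%:C :> K by rewrite subr_gt0 ltcR.
rewrite -ler_pdivlMr// div1r in geom.
apply: (@le_lt_trans _ _ ((q ^+ N)%:C * (1 - q%:C)^-1 * 2)).
  by rewrite ler_wpM2r// ler_wpM2l.
by rewrite -ltr_pdivlMr// ltr_pdivrMr// mulrAC.
Qed.

(** * Ladder operators on the orthonormal basis *)

Section Ladder.
Variables (q : R) (A B : H -> H).
Hypothesis hq : 0 < q < 1.
Hypotheses (bA : bounded_operator A) (bB : bounded_operator B).
Hypotheses (hA : q_annihilation q Phi A) (hB : q_creation q Phi B).

Let q0 : 0 < q := (andP hq).1.
Let q1 : q < 1 := (andP hq).2.

Lemma qnatS n : qnat q n.+1 = 1 + q * qnat q n.
Proof.
rewrite /qnat big_ord_recl expr0 mulr_sumr; congr (_ + _).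
by apply: eq_bigr => i _; rewrite exprS.
Qed.

Lemma qnatSr n : qnat q n.+1 = qnat q n + q ^+ n.
Proof. by rewrite /qnat big_ord_recr. Qed.

Lemma qnat_ge0 n : 0 <= qnat q n.
Proof. by apply: sumr_ge0 => i _; rewrite exprn_ge0// ltW. Qed.

(** This bound survives products, so the weights of iterated ladder operators are at least 1 as
    well. *)
Lemma sqrt_qnat_ge1 n : 1 <= (Num.sqrt (qnat q n.+1))%:C :> K.
Proof.
rewrite lecR -sqrtr1 ler_sqrt ?qnat_ge0// qnatS lerDl mulr_ge0 ?qnat_ge0//.
exact: ltW.
Qed.

Lemma sqrt_qnat_sqr n :
  (Num.sqrt (qnat q n))%:C * (Num.sqrt (qnat q n))%:C = (qnat q n)%:C.
Proof. by rewrite -rmorphM -expr2 sqr_sqrtr ?qnat_ge0. Qed.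

Lemma AB_Phi n : A (B (Phi n)) = (qnat q n.+1)%:C *: Phi n.
Proof. by rewrite hB (linear_mapZ A) ?hA.2 ?scalerA ?sqrt_qnat_sqr//; exact: bA.1. Qed.

Lemma BA_Phi n : B (A (Phi n)) = (qnat q n)%:C *: Phi n.
Proof.
case: n => [|n]; last first.
  by rewrite hA.2 (linear_mapZ B) ?hB ?scalerA ?sqrt_qnat_sqr//; exact: bB.1.
rewrite hA.1 (linear_map0 B); last exact: bB.1.
by rewrite /qnat big_ord0 scale0r.
Qed.

(** Both sides are bounded operators, so comparing them on the basis suffices; there the relation
    reads [{n+1} = 1 + q {n}]. *)
Lemma qcommutation x : A (B x) = x + q%:C *: B (A x).
Proof.
have [_ b1 /submod_closedP[b0 bL] bM] := @bounded_operator_unital K H.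
suff /(congr1 (fun f : H -> H => f x)) : A \o B = q%:C *: (B \o A) + id.
  by rewrite !fctE => ->; rewrite addrC.
apply: bounded_operator_ext; [exact: bM|by apply: bL => //; exact: bM|].
move=> n; rewrite -[LHS]/(A (B _)) -[RHS]/(q%:C *: B (A (Phi n)) + Phi n).
rewrite AB_Phi BA_Phi qnatS scalerA rmorphD rmorphM scalerDl scale1r.
by rewrite addrC.
Qed.

Lemma compact_lie_AB : compact_operator (lie A B).
Proof.
have [_ b1 /submod_closedP[b0 bL] bM] := @bounded_operator_unital K H.
apply: (compact_diagonal q) => //.
  by rewrite /lie addrC -scaleN1r; apply: bL; exact: bM.
move=> n; rewrite lieE AB_Phi BA_Phi -scalerBl -rmorphB/= qnatSr.
by rewrite addrC addKr.
Qed.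

Lemma iterA_Phi l n : exists2 w : K, 1 <= w & iter l A (Phi (l + n)) = w *: Phi n.
Proof.
elim: l n => [|l IH] n; first by exists 1; rewrite ?scale1r.
have [w w1 IHw] := IH n; exists ((Num.sqrt (qnat q (l + n).+1))%:C * w).
  by rewrite mulr_ege1// sqrt_qnat_ge1.
rewrite iterSr addSn hA.2 (linear_mapZ (iter l A)) ?IHw ?scalerA//.
exact/linear_iter/bA.1.
Qed.

Lemma iterB_Phi l n : exists2 w : K, 1 <= w & iter l B (Phi n) = w *: Phi (l + n).
Proof.
elim: l n => [|l IH] n; first by exists 1; rewrite ?scale1r.
have [w w1 IHw] := IH n; exists (w * (Num.sqrt (qnat q (l + n).+1))%:C).
  by rewrite mulr_ege1// sqrt_qnat_ge1.
by rewrite iterS IHw (linear_mapZ B) ?hB ?scalerA//; exact: bB.1.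
Qed.

(** The condition on [n] keeps powers of [A] from annihilating [Phi n]; then [n - m] is nonnegative
    and the absolute value only turns it into a natural number. *)
Lemma ladder_Phi m n : (`|m| <= n)%N ->
  exists2 w : K, 1 <= w & ladder A B m (Phi n) = w *: Phi `|n%:Z - m|%N.
Proof.
case: m => l /= ln.
  have [w w1 wP] := iterA_Phi l (n - l); exists w => //.
  by rewrite subzn// absz_nat -wP subnKC.
have [w w1 wP] := iterB_Phi l.+1 n; exists w => //.
by rewrite -[LHS]/(iter l.+1 B (Phi n)) wP; congr (_ *: Phi _); lia.
Qed.

(* If [c m0 != 0], the images of a sparse sequence of basis vectors are [|c m0|]-
   separated: they differ by that much in the coordinate reached by [ladder m0],
   because the weights of the ladder operators are at least [1]. *)
Lemma compact_ladder Y : lin_span (range (ladder A B)) Y -> compact_operator Y ->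
  Y = 0.
Proof.
move=> /lin_span_sum_uniq[s [c [us YE]]] /compact_operatorE[lY bY].
rewrite YE big_seq big1// => m0 m0s; suff -> : c m0 = 0 by rewrite scale0r.
apply/eqP; apply: contraT => cm0.
pose N := (\max_(m <- s) `|m|)%N.
have mN m : m \in s -> (`|m| <= N)%N.
  by move=> ms; rewrite /N (bigD1_seq m)//= leq_maxl.
have coef m n t : m \in s -> (N <= n)%N -> exists2 w : K, 1 <= w &
    ip (ladder A B m (Phi n)) (Phi t) = w * (`|n%:Z - m|%N == t)%:R.
  move=> ms Nn; have [w w1 ->] := ladder_Phi m n (leq_trans (mN m ms) Nn).
  by exists w => //; rewrite linearZl_LR/= hPhi.1.
have ipY n t : ip (Y (Phi n)) (Phi t) =
    \sum_(m <- s) c m * ip (ladder A B m (Phi n)) (Phi t).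
  by rewrite -ip_suml YE fct_sumE.
(* [Y] sends [Phi (u j)] to basis vectors with indices within [N] of [u j]. Steps of [2 N + 1] keep
   these windows disjoint, and the offset [N] meets the condition of [ladder_Phi]. *)
pose u j := (N + j * (N.*2.+1))%N.
have [//||i [j [ij]]] := totally_bounded_separated
  _ (fun j => Y (Phi (u j))) `|c m0| _ bY.
- by rewrite normr_gt0.
- by move=> j; exists (Phi (u j)) => //=; rewrite Phi_norm.
suff : `|c m0| <= `|Y (Phi (u j)) - Y (Phi (u i))|.
  by move=> /le_lt_trans h /h; rewrite ltxx.
rewrite (le_trans _ (ip_Phi_le _ `|(u j)%:Z - m0|%N))// linearBl/= !ipY.
have Nu k : (N <= u k)%N by rewrite leq_addr.
(* As [i < j], the window around [u i] misses the coordinate [u j - m0]. *)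
rewrite [X in _ - X]big_seq [X in _ - X]big1 ?subr0; last first.
  move=> m ms; have [w _ ->] := coef m (u i) `|(u j)%:Z - m0|%N ms (Nu i).
  case: eqP => [|_]; last by rewrite !mulr0.
  have : (i.+1 * N.*2.+1 <= j * N.*2.+1)%N by rewrite leq_mul2r ij orbT.
  by move: (mN m ms) (mN m0 m0s); rewrite /u mulSn; move: (_ * _)%N (_ * _)%N; lia.
(* Distinct degrees send [Phi (u j)] to distinct basis vectors, so only [m0] contributes. *)
rewrite (bigD1_seq m0)//= big_seq_cond big1 ?addr0; last first.
  move=> m /andP[ms mm0]; have [w _ ->] := coef m (u j) `|(u j)%:Z - m0|%N ms (Nu j).
  case: eqP => [|_]; last by rewrite !mulr0.
  move: (mN m ms) (mN m0 m0s) mm0 (Nu j); move: (u j) => n.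
  by move=> nm nm0 /eqP; lia.
have [w w1 ->] := coef m0 (u j) `|(u j)%:Z - m0|%N m0s (Nu j).
rewrite eqxx mulr1 normrM ler_peMr// ger0_norm//.
by rewrite (le_trans ler01).
Qed.

End Ladder.

End HilbertSpace.

Theorem corollary4p6 (R : realType) (q : R) (hq : 0 < q < 1)
    (H : completeNormedModType R[i]) (ip : {dot H for Num.conj})
    (hip : hilbert_norm ip)
    (Phi : nat -> H) (hPhi : complete_orthonormal ip Phi)
    (A B : H -> H) (bA : bounded_operator A) (bB : bounded_operator B)
    (hA : q_annihilation q Phi A) (hB : q_creation q Phi B) :
  derived_algebra (L0 A B) =
    [set X | heisenberg_algebra A B X /\ compact_operator X].
Proof.
have [q0 q1] := andP hq.
have qC0 : (q%:C != 0)%C by rewrite gt_eqF// ltcR.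
have qCX k : ((q%:C) ^+ k.+1 != 1)%C.
  by rewrite lt_eqF// exprn_ilt1 ?ltcR// lecR ltW.
have AB := qcommutation ip Phi hPhi q A B hq bA bB hA hB.
have cI : comm_ideal A B `<=` compact_operator.
  apply: compact_comm_ideal => //.
  exact: (compact_lie_AB ip Phi hip hPhi q).
apply/seteqP; split=> [X /(derived_L0_sub A B _ bA bB AB qC0 qCX) IX|X [hX cX]].
  by split; [exact: comm_ideal_heisenberg|exact: cI].
apply: (comm_ideal_derived A B _ bA bB AB qC0 qCX).
have [Y [Z [LY IZ XE]]] := heisenberg_ladder A B _ bA bB AB qC0 qCX X hX.
(* [Y = X - Z] is a compact combination of ladder operators, hence zero, and [X = Z] lies in the
   ideal. *)
suff Y0 : Y = 0 by rewrite XE Y0 add0r.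
apply: (compact_ladder ip Phi hip hPhi q A B hq bA bB hA hB Y LY).
have -> : Y = -1 *: Z + X by rewrite XE scaleN1r addrC addrK.
by apply: compact_operatorP => //; exact: cI.
Qed.
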